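(* Let $\alpha\in[0,1]$. The functions $B^{\alpha}_{p,\tau}$, $p\in\mathbb{Z}$, $\tau=0,\ldots,\beta_\alpha(|p|)-1$, form an orthonormal basis of $L^2([0,1])$.
   Context: Fix $\alpha\in[0,1]$. Define integers iteratively by $i_{\alpha;0}=0$, $s_{\alpha;0}=1$, $\beta_\alpha(0)=1$ and, for $p\ge 1$, $i_{\alpha;p}=s_{\alpha;p-1}$, $\beta_\alpha(p)=\lfloor (i_{\alpha;p})^\alpha\rfloor$, $s_{\alpha;p}=i_{\alpha;p}+\lfloor (i_{\alpha;p})^\alpha\rfloor$, where $\lfloor x\rfloor$ is the integer part of $x$. For integers $p\ge 0$ and $\tau=0,\ldots,\beta_\alpha(p)-1$ set $$B^\alpha_{p,\tau}(t)=\frac{1}{\sqrt{\beta_\alpha(p)}}\sum_{\eta=i_{\alpha;p}}^{s_{\alpha;p}-1}e^{2\pi \mathrm{i}\,\eta\left(t-\frac{\tau}{\beta_\alpha(p)}\right)}.$$ For integers $p<0$ and $\tau=0,\ldots,\beta_\alpha(-p)-1$ set $B^\alpha_{p,\tau}(t)=\overline{B^\alpha_{-p,\tau}(t)}$. *)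

(* Defs.v *)
From HB Require Import structures.
From mathcomp Require Import all_boot all_order all_algebra.
From mathcomp Require Import all_classical all_reals all_analysis.
From mathcomp Require Import complex.

Set Implicit Arguments.
Unset Strict Implicit.
Unset Printing Implicit Defensive.
Import Order.TTheory GRing.Theory Num.Theory.
Import numFieldNormedType.Exports.
Local Open Scope classical_set_scope.
Local Open Scope ring_scope.
Local Open Scope complex_scope.

(** * The Hilbert space L^2([0,1]; C)

    Elements are represented by functions R -> R[i], of which only the values
    on [0,1] matter; almost-everywhere equality is identity up to L2norm. *)

Section L2.
Variable R : realType.
Implicit Types f g : R -> R[i].

Local Notation I01 := (`[0%R, 1%R]%classic : set R).

(** The patch [\_] extends a function by 0 outside [0,1]. *)
Definition L2norm f : \bar R :=
  'N[lebesgue_measure]_(2%:E)[(fun x : R => (ComplexField.Normc.normc (f x))%:E) \_ I01]%E.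

Definition inL2 f : Prop :=
  [/\ measurable_fun I01 (fun x : R => complex.Re (f x)),
      measurable_fun I01 (fun x : R => complex.Im (f x)) &
      (L2norm f < +oo)%E].

Definition Cintegral f : R[i] :=
  (\int[lebesgue_measure]_(x in I01) complex.Re (f x))
  +i* (\int[lebesgue_measure]_(x in I01) complex.Im (f x)).

Definition L2inner f g : R[i] := Cintegral (fun x => f x * (g x)^*).

Definition orthonormal_basis (J : eqType) (e : J -> R -> R[i]) : Prop :=
  [/\ forall j, inL2 (e j),
      forall j k, L2inner (e j) (e k) = (j == k)%:R &
      (* finite linear combinations are dense in L^2([0,1]) *)
      forall f, inL2 f -> forall eps : R, 0 < eps ->
        exists (s : seq J) (c : J -> R[i]),
          (L2norm (fun x => f x - \sum_(j <- s) c j * e j x)%R < eps%:E)%E].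

End L2.

Section Basis.
Variables (R : realType) (alpha : R).

(** The pair (i_{alpha;p}, s_{alpha;p}). On nonnegative reals, Num.truncn is
    the integer part. *)
Fixpoint band (p : nat) : nat * nat :=
  if p is q.+1 then
    let i := (band q).2 in (i, i + Num.truncn (i%:R `^ alpha))%N
  else (0, 1)%N.

Definition band_i (p : nat) : nat := (band p).1.

Definition band_s (p : nat) : nat := (band p).2.

Definition band_beta (p : nat) : nat :=
  if p is 0 then 1%N else Num.truncn ((band_i p)%:R `^ alpha).

(** e^{i x}, for real x *)
Definition expi (x : R) : R[i] := cos x +i* sin x.

Definition Bnat (p tau : nat) (t : R) : R[i] :=
  ((Num.sqrt (band_beta p)%:R)^-1)%:C *
  \sum_(band_i p <= eta < band_s p)
    expi (2 * pi * eta%:R * (t - tau%:R / (band_beta p)%:R)).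

Definition B (p : int) (tau : nat) (t : R) : R[i] :=
  if 0 <= p then Bnat `|p|%N tau t else (Bnat `|p|%N tau t)^*.

(** The pairs (p, tau) with p an integer and 0 <= tau < band_beta |p|. *)
Definition Bindex : eqType := {p : int & 'I_(band_beta `|p|%N)}.

Definition Bfam (j : Bindex) : R -> R[i] := B (tag j) (tagged j).

End Basis.

(* Main.v *)
(** The exponentials [wave n t = e^(2 i pi n t)], [n] an integer, are
    orthonormal. The functions [B p tau], for a fixed [p], are the image of the
    exponentials with frequency in the [p]-th band under a unitary discrete
    Fourier transform, and the bands with their opposites partition the
    integers; so the family is orthonormal and has the same span as the
    exponentials.

    For the density of trigonometric polynomials, fix [0 < b <= 1]. The
    trigonometric polynomial [t(x) = 1/2 - sin (pi x) sin (pi (b - x)) / 2] takes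
    its values in [0,1], and on ]0,1[ it is below, at or above [1/2] according to
    [x] being below, at or above [b]. Hence [(1 - t^n)^(2^n)] converges boundedly
    and almost everywhere to the indicator of [x < b]. Dynkin's pi-lambda theorem
    extends the approximation to indicators of all measurable sets, and simple
    functions with dominated convergence extend it to L^2. *)

From HB Require Import structures.
Require Import Defs.
From mathcomp Require Import all_boot all_order all_algebra.
From mathcomp Require Import all_classical all_reals all_analysis.
From mathcomp Require Import complex measurable_realfun.
From mathcomp Require Import ring lra zify.
Import Order.TTheory GRing.Theory Num.Theory.
Import numFieldNormedType.Exports.

Set Implicit Arguments.
Unset Strict Implicit.
Unset Printing Implicit Defensive.
Local Open Scope classical_set_scope.
Local Open Scope complex_scope.
Local Open Scope ring_scope.

(** * Exponentials and frequency bands *)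

Section Span.
Variable R : realType.

(** A list of pairs may repeat an index, so sums are concatenations and no decidable equality on [J]
    is involved. *)
Definition in_span (J : Type) (e : J -> R -> R[i]) (f : R -> R[i]) : Prop :=
  exists l : seq (J * R[i]), f = fun x => \sum_(p <- l) p.2 * e p.1 x.

Section Closure.
Variables (J : Type) (e : J -> R -> R[i]).

Lemma in_span_gen j : in_span e (e j).
Proof.
by exists [:: (j, 1)]; apply/funext => x; rewrite big_seq1 mul1r.
Qed.

Lemma in_spanD f g :
  in_span e f -> in_span e g -> in_span e (fun x => f x + g x).
Proof.
move=> [l ->] [m ->]; exists (l ++ m); apply/funext => x.
by rewrite big_cat.
Qed.

Lemma in_spanZ a f : in_span e f -> in_span e (fun x => a * f x).
Proof.
move=> [l ->]; exists [seq (p.1, a * p.2) | p <- l]; apply/funext => x.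
by rewrite big_map mulr_sumr; apply: eq_bigr => p _; rewrite mulrA.
Qed.

Lemma in_span_sum (I : Type) (r : seq I) (P : pred I) (F : I -> R -> R[i]) :
  (forall i, P i -> in_span e (F i)) ->
  in_span e (fun x => \sum_(i <- r | P i) F i x).
Proof.
move=> eF; elim: r => [|i r IH].
  by exists [::]; apply/funext => x; rewrite !big_nil.
have [Pi|Pi] := boolP (P i); last first.
  by under eq_fun do rewrite big_cons (negbTE Pi).
under eq_fun do rewrite big_cons Pi.
by apply: in_spanD => //; exact: eF.
Qed.

End Closure.

Lemma in_span_trans (J K : Type) (e : J -> R -> R[i]) (d : K -> R -> R[i]) f :
  (forall j, in_span d (e j)) -> in_span e f -> in_span d f.
Proof.
move=> ed [l ->]; apply: in_span_sum => p _.
by apply: in_spanZ; exact: ed.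
Qed.

(** Converts to the form used in [orthonormal_basis], where the coefficient is a function of the
    index: the coefficients of repeated indices are added up. *)
Lemma in_span_uniq (J : eqType) (e : J -> R -> R[i]) f : in_span e f ->
  exists (s : seq J) (c : J -> R[i]), f = fun x => \sum_(j <- s) c j * e j x.
Proof.
move=> [l ->]; exists (undup (map fst l)), (fun j => \sum_(p <- l | p.1 == j) p.2).
apply/funext => x; under [RHS]eq_bigr do rewrite mulr_suml.
(* After the exchange, a pair [p] of [l] meets exactly one index of the duplicate-free list, namely
   [p.1]. *)
rewrite (exchange_big_dep xpredT)//= big_seq [RHS]big_seq.
apply: eq_bigr => p pl.
rewrite (big_rem p.1)/=; last by rewrite mem_undup map_f.
rewrite eqxx big1_seq ?addr0// => j /andP[/eqP <-].
by rewrite mem_rem_uniq ?undup_uniq// !inE eqxx.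
Qed.

End Span.

Section Exponentials.
Variable R : realType.
Implicit Types (x y : R) (n m : int).

Lemma expiD x y : expi (x + y) = expi x * expi y.
Proof. by rewrite /expi cosD sinD; simpc; rewrite [_ * sin y + _]addrC mulrC. Qed.

Lemma expi0 : expi (0 : R) = 1.
Proof. by rewrite /expi cos0 sin0. Qed.

Lemma conjc_expi x : (expi x)^*%C = expi (- x).
Proof. by rewrite /expi cosN sinN. Qed.

Definition wave n x : R[i] := expi (2 * pi * n%:~R * x).

Lemma waveDl n m x : wave (n + m) x = wave n x * wave m x.
Proof. by rewrite /wave -expiD intrD; congr expi; ring. Qed.

Lemma waveDr n x y : wave n (x + y) = wave n x * wave n y.
Proof. by rewrite /wave -expiD; congr expi; ring. Qed.

Lemma wave0l x : wave 0 x = 1.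
Proof. by rewrite /wave mulr0 mul0r expi0. Qed.

Lemma wave0r n : wave n 0 = 1.
Proof. by rewrite /wave mulr0 expi0. Qed.

Lemma conjc_wave n x : (wave n x)^*%C = wave (- n) x.
Proof. by rewrite /wave conjc_expi; congr expi; rewrite intrN; ring. Qed.

Lemma waveNr n x : wave n (- x) = wave (- n) x.
Proof. by rewrite /wave; congr expi; rewrite intrN; ring. Qed.

Lemma wave_swap n (k : nat) x : wave n (k%:R * x) = wave (k%:Z * n) x.
Proof. by rewrite /wave; congr expi; rewrite intrM -pmulrn; ring. Qed.

Lemma waveX n (k : nat) x : wave n (k%:R * x) = wave n x ^+ k.
Proof.
elim: k => [|k IH]; first by rewrite mul0r wave0r expr0.
by rewrite -natr1 mulrDl waveDr IH mul1r exprSr.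
Qed.

Lemma wave1r n : wave n 1 = 1.
Proof.
have wave11 : wave 1 1 = 1 by rewrite /wave mulr1 mulr1 mulr_natl /expi cos2pi sin2pi.
have wavek1 (k : nat) : wave k 1 = 1.
  by rewrite -[k%:Z]mulr1 -wave_swap waveX wave11 expr1n.
case: n => k; first exact: wavek1.
by rewrite NegzE -conjc_wave wavek1 rmorph1.
Qed.

(** The real part suffices. With [y = pi |m| / N] in ]0, pi[, one has [sin y > 0], so
    [cos (2 y) = 1 - 2 sin^2 y] is below 1. *)
Lemma wave_neq1 m (N : nat) : m != 0 -> (`|m| < N)%N -> wave m (N%:R^-1) != 1.
Proof.
move=> m0 mN; apply/negP => /eqP[cos1 _].
have N0 : (0 : R) < N%:R by rewrite ltr0n (leq_ltn_trans _ mN).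
pose y : R := pi * (`|m|%N%:R / N%:R).
have y0pi : 0 < y < pi.
  rewrite mulr_gt0 ?pi_gt0 ?(divr_gt0 _ N0) ?ltr0n ?absz_gt0//=.
  by rewrite -[ltRHS]mulr1 ltr_pM2l ?pi_gt0// ltr_pdivrMr// mul1r ltr_nat.
have : cos (y *+ 2) = 1.
  rewrite -cos1 -[RHS]cos_norm; congr cos.
  rewrite !normrM normfV !normr_nat (ger0_norm (pi_ge0 R)) /y.
  by rewrite natr_absz intr_norm mulr2n; ring.
rewrite cos_mulr2n => cos2y.
have := sin_gt0_pi y0pi; rewrite lt_def => /andP[+ _].
by rewrite -sqrf_eq0 sin2cos2 => /eqP; apply; lra.
Qed.

(** The summands are the powers of [w = wave m (1 / N)], an [N]-th root of unity other than 1 when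
    [m != 0]; the geometric sum then vanishes because [(w - 1)] times it is [w ^ N - 1 = 0]. *)
Lemma sum_wave m (N : nat) : (`|m| < N)%N ->
  \sum_(k < N) wave m (k%:R / N%:R) = if m == 0 then N%:R else 0.
Proof.
move=> mN; have N0 : (N%:R : R) != 0 by rewrite pnatr_eq0; case: N mN.
case: eqVneq => [->|m0].
  by under eq_bigr do rewrite wave0l; rewrite sumr_const card_ord.
under eq_bigr do rewrite waveX.
have := subrX1 (wave m (N%:R^-1)) N.
rewrite -waveX mulfV// wave1r subrr => /esym/eqP.
by rewrite mulf_eq0 subr_eq0 (negbTE (wave_neq1 m0 mN)) => /eqP.
Qed.

End Exponentials.
Arguments wave {R} n x.

(** * Partition of the integers into frequency bands *)

Section Bands.
Variables (R : realType) (alpha : R).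
Hypothesis alpha_ge0 : 0 <= alpha.
Local Notation beta := (band_beta alpha).
Local Notation bi := (band_i alpha).
Local Notation bs := (band_s alpha).

Lemma band_iS p : bi p.+1 = bs p.
Proof. by []. Qed.

Lemma band_s_gt0 p : (0 < bs p)%N.
Proof. by elim: p => //= p IH; rewrite /band_s /= addn_gt0 IH. Qed.

Lemma band_sE p : bs p = (bi p + beta p)%N.
Proof. by case: p. Qed.

(** For [n >= 1] and [alpha >= 0], [n ^ alpha >= n ^ 0 = 1], so the integer part is at least 1. *)
Lemma band_beta_gt0 p : (0 < beta p)%N.
Proof.
case: p => // p; rewrite /band_beta band_iS truncn_gt0.
by rewrite -[leLHS](powRr0 (bs p)%:R) ler_powR// ler1n band_s_gt0.
Qed.

Lemma band_i_lt_s p : (bi p < bs p)%N.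
Proof. by rewrite band_sE -[ltnLHS]addn0 ltn_add2l band_beta_gt0. Qed.

Lemma band_s_mono p q : (p < q)%N -> (bs p <= bi q)%N.
Proof.
elim: q => // q IH; rewrite ltnS leq_eqVlt => /predU1P[->|pq]; first exact: leqnn.
by rewrite band_iS (leq_trans (IH pq))// ltnW// band_i_lt_s.
Qed.

Lemma band_inj p q n : (bi p <= n < bs p)%N -> (bi q <= n < bs q)%N -> p = q.
Proof.
move=> /andP[pn np] /andP[qn nq].
have [pq|qp|//] := ltngtP p q.
  by have := leq_trans np (leq_trans (band_s_mono pq) qn); rewrite ltnn.
by have := leq_trans nq (leq_trans (band_s_mono qp) pn); rewrite ltnn.
Qed.

(** The band of [n] is the first [p] with [n < s_p]; one exists because the [s_p] increase strictly,
    so that [s_n > n]. *)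
Lemma band_cover n : exists p, (bi p <= n < bs p)%N.
Proof.
have ex : exists p, (n < bs p)%N.
  exists n; elim: n => [|n IH]; first exact: band_s_gt0.
  by apply: (leq_ltn_trans IH); rewrite -band_iS band_i_lt_s.
case: (ex_minnP ex) => -[|p] np pmin; first by exists 0%N; rewrite np.
exists p.+1; rewrite np andbT band_iS leqNgt; apply/negP => /pmin.
by rewrite ltnn.
Qed.

(** Negative [p] carries the opposite frequencies: [(wave n)^* = wave (- n)]. *)
Definition freq (p : int) (k : nat) : int := if 0 <= p then k%:Z else - k%:Z.

(** Equal frequencies have equal absolute values, hence lie in the same band up to sign. Only the
    frequency 0 equals its opposite, and it belongs to the band 0, which has a single index
    [p = 0]. *)
Lemma freq_inj p q k l : (bi `|p| <= k < bs `|p|)%N ->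
  (bi `|q| <= l < bs `|q|)%N -> freq p k = freq q l -> p = q /\ k = l.
Proof.
move=> pk ql; rewrite /freq => kl.
have ekl : k = l by move: kl; case: (lerP 0 p); case: (lerP 0 q); lia.
rewrite -ekl in ql kl; have pq := band_inj pk ql.
split=> //; case: (posnP k) => k0.
  have r0 : `|p|%N = 0%N.
    by apply: (band_inj pk); rewrite k0 /band_i /band_s.
  by move: r0 pq; lia.
by move: kl pq; case: (lerP 0 p); case: (lerP 0 q); lia.
Qed.

Lemma freq_cover n : exists p k, (bi `|p| <= k < bs `|p|)%N /\ freq p k = n.
Proof.
have [p pn] := band_cover `|n|%N.
case: (lerP 0 n) => n0.
  by exists p%:Z, `|n|%N; split => //; rewrite /freq /= gez0_abs.
exists (- p%:Z), `|n|%N; rewrite abszN; split => //; rewrite /freq.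
(* For [p = 0] the index [- p] counts as nonnegative, but the band 0 contains only 0, which
   contradicts [n < 0]. *)
case: ifP => p0; last by rewrite ltz0_abs// opprK.
by have p0' : p = 0%N; [lia|move: pn; rewrite p0' /band_i/band_s /=; lia].
Qed.

(** The translation by [tau / beta] splits off as a phase on each exponential, and for negative [p]
    conjugation negates every frequency, which is the sign recorded by [freq]. *)
Lemma B_wave (p : int) (tau : nat) (t : R) :
  B alpha p tau t = ((Num.sqrt (beta `|p|)%:R)^-1)%:C *
    \sum_(k < beta `|p|) wave (freq p (bi `|p| + k)) t *
                         wave (- freq p (bi `|p| + k)) (tau%:R / (beta `|p|)%:R).
Proof.
have BnatE q : Bnat alpha q tau t = ((Num.sqrt (beta q)%:R)^-1)%:C *
    \sum_(k < beta q) wave (bi q + k)%N (t - tau%:R / (beta q)%:R).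
  rewrite /Bnat band_sE -[X in \sum_(X <= _ < _) _]add0n big_addn.
  rewrite addKn big_mkord; congr (_ * _); apply: eq_bigr => k _.
  by rewrite /wave pmulrn addnC.
rewrite /B /freq; case: ifP => p0; rewrite BnatE.
  by congr (_ * _); apply: eq_bigr => k _; rewrite waveDr waveNr.
rewrite rmorphM; congr (_ * _); first exact: conjc_real.
rewrite rmorph_sum; apply: eq_bigr => k _.
by apply: etrans (conjc_wave _ _) _; rewrite waveDr waveNr.
Qed.

End Bands.

(** * Integrals of trigonometric polynomials *)

Section ComplexParts.
Variable R : realType.
Implicit Types a b : R[i].
Local Notation Re := complex.Re.
Local Notation Im := complex.Im.
Local Notation normc := ComplexField.Normc.normc.

Lemma Re_addc a b : Re (a + b) = Re a + Re b.
Proof. by case: a b => ? ? []. Qed.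

Lemma Im_addc a b : Im (a + b) = Im a + Im b.
Proof. by case: a b => ? ? []. Qed.

Lemma Re_mulc a b : Re (a * b) = Re a * Re b - Im a * Im b.
Proof. by case: a b => ? ? []. Qed.

Lemma Im_mulc a b : Im (a * b) = Re a * Im b + Im a * Re b.
Proof. by case: a b => ? ? [] ? ?. Qed.

Lemma Re_subc a b : Re (a - b) = Re a - Re b.
Proof. by case: a b => ? ? []. Qed.

Lemma Im_subc a b : Im (a - b) = Im a - Im b.
Proof. by case: a b => ? ? []. Qed.

Lemma sqr_normcE a : normc a ^+ 2 = Re a ^+ 2 + Im a ^+ 2.
Proof. by case: a => x y; rewrite /normc sqr_sqrtr// addr_ge0// sqr_ge0. Qed.

End ComplexParts.

Section Continuous.
Variable R : realType.
Local Notation Re := complex.Re.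
Local Notation Im := complex.Im.
Local Notation mu := (@lebesgue_measure R).
Local Notation I01 := (`[0%R, 1%R]%classic : set R).
Implicit Types f g : R -> R[i].

Definition ccontinuous f : Prop :=
  continuous (fun x => Re (f x)) /\ continuous (fun x => Im (f x)).

Lemma ccontinuousD f g : ccontinuous f -> ccontinuous g ->
  ccontinuous (fun x => f x + g x).
Proof.
move=> [cf df] [cg dg]; split=> x.
  by under eq_fun do rewrite Re_addc; apply: continuousD; [exact: cf|exact: cg].
by under eq_fun do rewrite Im_addc; apply: continuousD; [exact: df|exact: dg].
Qed.

Lemma ccontinuousM f g : ccontinuous f -> ccontinuous g ->
  ccontinuous (fun x => f x * g x).
Proof.
move=> [cf df] [cg dg]; split=> x.
  under eq_fun do rewrite Re_mulc.
  by apply: cvgB; apply: cvgM;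
    [exact: cf|exact: cg|exact: df|exact: dg].
under eq_fun do rewrite Im_mulc.
by apply: cvgD; apply: cvgM;
  [exact: cf|exact: dg|exact: df|exact: cg].
Qed.

Lemma ccontinuous_cst (a : R[i]) : ccontinuous (fun=> a).
Proof. by split=> x; exact: cst_continuous. Qed.

Lemma ccontinuous_wave n : ccontinuous (wave n).
Proof.
by split=> x; (apply: continuous_comp; first exact: mulrl_continuous);
  [exact: continuous_cos|exact: continuous_sin].
Qed.

Lemma ccontinuous_span f : in_span wave f -> ccontinuous f.
Proof.
move=> [l ->]; elim: l => [|p l IH].
  by under eq_fun do rewrite big_nil; exact: ccontinuous_cst.
under eq_fun do rewrite big_cons.
apply: ccontinuousD => //; apply: ccontinuousM; first exact: ccontinuous_cst.
exact: ccontinuous_wave.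
Qed.

Lemma continuous_integrable (h : R -> R) : continuous h ->
  mu.-integrable I01 (EFin \o h).
Proof.
move=> ch; apply: continuous_compact_integrable; first exact: segment_compact.
exact: continuous_subspaceT.
Qed.

Lemma CintegralD f g : ccontinuous f -> ccontinuous g ->
  Cintegral (fun x => f x + g x) = Cintegral f + Cintegral g.
Proof.
move=> [cf df] [cg dg]; rewrite /Cintegral; simpc; congr (_ +i* _).
  under eq_Rintegral do rewrite Re_addc.
  by rewrite RintegralD//; exact: continuous_integrable.
under eq_Rintegral do rewrite Im_addc.
by rewrite RintegralD//; exact: continuous_integrable.
Qed.

Lemma CintegralZ a f : ccontinuous f ->
  Cintegral (fun x => a * f x) = a * Cintegral f.
Proof.
move=> [cf df]; case: a => a b; rewrite /Cintegral; simpc.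
have iR (c : R) (h : R -> R) : continuous h ->
    mu.-integrable I01 (EFin \o (fun x => c * h x)).
  move=> ch; apply: continuous_integrable => x.
  by apply: continuousM; [exact: cst_continuous|exact: ch].
congr (_ +i* _).
  under eq_Rintegral do rewrite Re_mulc /=.
  by rewrite RintegralB ?RintegralZl//;
    [exact: continuous_integrable|exact: continuous_integrable|exact: iR|exact: iR].
under eq_Rintegral do rewrite Im_mulc /=.
by rewrite RintegralD ?RintegralZl//;
  [exact: continuous_integrable|exact: continuous_integrable|exact: iR|exact: iR].
Qed.

Lemma Rintegral_FTC (h H : R -> R) : continuous h ->
  (forall x : R, is_derive x 1 H (h x)) -> \int[mu]_(x in I01) h x = H 1 - H 0.
Proof.
move=> ch dH; rewrite /Rintegral (@continuous_FTC2 _ h H)//.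
- exact: continuous_subspaceT.
- have cH : continuous H.
    by move=> x; apply/differentiable_continuous/derivable1_diffP; exact: ex_derive.
  split=> [x _||]; [exact: ex_derive|apply: cvg_at_right_filter|
    apply: cvg_at_left_filter]; exact: cH.
- by move=> x _; rewrite derive1E derive_val.
Qed.

(** For [n != 0] the real and imaginary parts have the antiderivatives [sin] and [- cos] of
    [2 pi n x], divided by [2 pi n]; these agree at 0 and 1. *)
Lemma Cintegral_wave n : Cintegral (wave n) = (n == 0)%:R :> R[i].
Proof.
case: eqVneq => [->|n0].
  rewrite /Cintegral; under eq_Rintegral do rewrite wave0l.
  under [X in _ +i* X]eq_Rintegral do rewrite wave0l.
  rewrite !Rintegral_cst//= lebesgue_measure_itv/= lte01 oppr0 addr0/=.
  by rewrite mulr1 mul0r.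
have [cE dE] := ccontinuous_wave n.
have w0 : 2 * pi * n%:~R != 0 :> R.
  by rewrite !mulf_neq0// ?intr_eq0//; exact: lt0r_neq0 (pi_gt0 R).
have [c1 s1] : expi (2 * pi * n%:~R) = 1 :> R[i] by rewrite -(wave1r R n) /wave mulr1.
rewrite /Cintegral.
have dS (x : R) : is_derive x 1
    (fun x : R => (2 * pi * n%:~R)^-1 * sin (2 * pi * n%:~R * x)) (Re (wave n x)).
  apply: is_derive_eq; rewrite /GRing.scale /= mulr1 /wave /=.
  by move: (2 * pi * n%:~R) w0 => w w0; field.
have dC (x : R) : is_derive x 1
    (fun x : R => - (2 * pi * n%:~R)^-1 * cos (2 * pi * n%:~R * x)) (Im (wave n x)).
  apply: is_derive_eq; rewrite /GRing.scale /= mulr1 /wave /=.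
  by move: (2 * pi * n%:~R) w0 => w w0; field.
rewrite (Rintegral_FTC cE dS) (Rintegral_FTC dE dC).
by rewrite !mulr1 c1 s1 !mulr0 cos0 sin0 mulr0 !subrr.
Qed.

(** The frequencies [n i] may coincide, so that the lemma applies to the double sum obtained by
    expanding a product of two trigonometric polynomials. *)
Lemma Cintegral_sum_wave (I : Type) (r : seq I) (c : I -> R[i]) (n : I -> int) :
  Cintegral (fun x => \sum_(i <- r) c i * wave (n i) x) =
  \sum_(i <- r) c i * (n i == 0)%:R.
Proof.
elim: r => [|i r IH].
  rewrite big_nil /Cintegral; under eq_Rintegral do rewrite big_nil.
  under [X in _ +i* X]eq_Rintegral do rewrite big_nil.
  by rewrite !Rintegral_cst//= !mul0r.
under eq_fun do rewrite big_cons.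
rewrite big_cons CintegralD.
- by rewrite IH CintegralZ ?Cintegral_wave//; exact: ccontinuous_wave.
- by apply: ccontinuousM; [exact: ccontinuous_cst|exact: ccontinuous_wave].
- apply: ccontinuous_span; exists [seq (n i, c i) | i <- r].
  by apply/funext => x; rewrite big_map.
Qed.

End Continuous.

(** * Orthonormality and span *)

Section Conjugation.
Variable R : realType.

(* [^*] denotes [Num.conj] in [ring_scope] but [conjc] in [complex_scope]. *)
Lemma num_conjE (a : R[i]) : Num.conj a = a^*%C.
Proof. by []. Qed.

Lemma conjcM (a b : R[i]) : (a * b)^*%C = a^*%C * b^*%C.
Proof. exact: (rmorphM conjc). Qed.

Lemma conjc_sum (I : Type) (r : seq I) (F : I -> R[i]) :
  (\sum_(i <- r) F i)^*%C = \sum_(i <- r) (F i)^*%C.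
Proof. exact: (rmorph_sum conjc). Qed.

End Conjugation.

Section Orthonormal.
Variables (R : realType) (alpha : R).
Hypothesis alpha_ge0 : 0 <= alpha.
Local Notation beta p := (band_beta alpha `|p|).
Local Notation bi p := (band_i alpha `|p|).

Definition band_sign (p : int) : int := if 0 <= p then 1 else -1.

Lemma freqE p k : freq p k = band_sign p * k%:Z.
Proof. by rewrite /freq /band_sign; case: ifP; rewrite ?mul1r ?mulN1r. Qed.

(** Symmetry of the Fourier kernel: it lets a sum over frequencies [k] be read as a sum over the
    sample points [k / beta], the form handled by [sum_wave]. *)
Lemma wave_exchange (s : int) (k t : nat) (x : R) :
  wave (s * k%:Z) (t%:R * x) = wave (s * t%:Z) (k%:R * x).
Proof. by rewrite !wave_swap; congr wave; ring. Qed.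

(** The entry at row [tau] and column [k] of the normalized discrete Fourier matrix of order [beta],
    up to a phase depending on [tau] that comes from the first frequency of the band. *)
Definition band_coef (p : int) (tau k : nat) : R[i] :=
  ((Num.sqrt (beta p)%:R)^-1)%:C *
  wave (- freq p (bi p + k)) (tau%:R / (beta p)%:R : R).

Lemma B_sum (p : int) (tau : nat) (t : R) : B alpha p tau t =
  \sum_(k < beta p) band_coef p tau k * wave (freq p (bi p + k)) t.
Proof.
rewrite B_wave mulr_sumr; apply: eq_bigr => k _.
by rewrite /band_coef mulrAC mulrA.
Qed.

Lemma sqrt_betaV2 (p : int) : ((Num.sqrt (beta p)%:R)^-1)%:C ^+ 2 =
  ((beta p)%:R)^-1 :> R[i].
Proof.
rewrite -rmorphXn exprVn sqr_sqrtr ?ler0n// fmorphV.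
by rewrite rmorph_nat.
Qed.

Lemma beta_neq0 (p : int) : (beta p)%:R != 0 :> R[i].
Proof. by rewrite pnatr_eq0 -lt0n band_beta_gt0. Qed.

Lemma band_i_addE (p : int) (k : 'I_(beta p)) :
  (bi p <= bi p + k < band_s alpha `|p|)%N.
Proof. by rewrite band_sE leq_addr ltn_add2l ltn_ord. Qed.

Lemma freq_band_eq (p : int) (k l : 'I_(beta p)) :
  (freq p (bi p + k) == freq p (bi p + l)) = (k == l).
Proof.
apply/eqP/eqP => [|->//] kl; apply: val_inj.
have [_ /addnI] := freq_inj alpha_ge0 (band_i_addE k) (band_i_addE l) kl.
by [].
Qed.

(** The rows of the Fourier matrix are orthonormal: apart from phases independent of [k], the [k]-th
    product is [wave d (k / beta)] with [d] equal to [tau' - tau] up to sign. *)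
Lemma sum_band_coef (p : int) (tau tau' : 'I_(beta p)) :
  \sum_(k < beta p) band_coef p tau k * (band_coef p tau' k)^*%C = (tau == tau')%:R.
Proof.
pose x (t : nat) : R := t%:R / (beta p)%:R.
pose d : int := band_sign p * tau'%:Z - band_sign p * tau%:Z.
transitivity (wave (freq p (bi p)) (x tau') * wave (- freq p (bi p)) (x tau) *
    ((beta p)%:R^-1 * \sum_(k < beta p) wave d (x k))).
  rewrite !mulr_sumr; apply: eq_bigr => k _.
  rewrite /band_coef; set s := _%:C.
  have -> : (s * wave (- freq p (bi p + k)) (tau'%:R / (beta p)%:R))^*%C =
      s * wave (freq p (bi p + k)) (x tau').
    rewrite conjcM; congr (_ * _); first exact: conjc_real.
    by rewrite conjc_wave opprK.
  rewrite -sqrt_betaV2 -/s expr2 /d !freqE PoszD mulrDr opprD !waveDl.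
  rewrite -![wave (- (band_sign p * k%:Z)) _]waveNr -mulrN.
  rewrite (wave_exchange _ k tau').
  rewrite -[wave (- (band_sign p * tau%:Z)) _]waveNr.
  have -> : wave (band_sign p * k%:Z) (- (tau%:R / (beta p)%:R) : R) =
      wave (band_sign p * tau%:Z) (- x k).
    by rewrite /x !waveNr -!mulNr wave_exchange.
  rewrite /x; ring.
(* Both indices are below [beta], so [d] is a multiple of [beta] only if it is 0. *)
have db : (`|d| < beta p)%N.
  have := ltn_ord tau; have := ltn_ord tau'.
  by rewrite /d /band_sign; case: ifP => _; lia.
rewrite sum_wave//; have -> : (d == 0) = (tau == tau').
  rewrite -val_eqE /d /band_sign; case: ifP => _; apply/eqP/eqP => /=; lia.
case: eqVneq => [->|_]; last by rewrite !mulr0.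
by rewrite mulVf ?beta_neq0// mulr1 -waveDl subrr wave0l.
Qed.

(** A product of one exponential with the conjugate of another has the difference of their
    frequencies, and the integral keeps only the frequency 0. *)
Lemma L2inner_B (p q : int) (tau : 'I_(beta p)) (tau' : 'I_(beta q)) :
  L2inner (B alpha p tau) (B alpha q tau') =
  \sum_(k < beta p) \sum_(l < beta q)
    band_coef p tau k * (band_coef q tau' l)^*%C *
    (freq p (bi p + k) == freq q (bi q + l))%:R.
Proof.
rewrite pair_bigA.
under [RHS]eq_bigr do rewrite -subr_eq0.
rewrite -Cintegral_sum_wave /L2inner; congr Cintegral; apply/funext => x.
rewrite num_conjE !B_sum conjc_sum mulr_suml.
under eq_bigr do rewrite mulr_sumr.
rewrite pair_bigA; apply: eq_bigr => -[k l] _; rewrite /fst /snd.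
by rewrite conjcM conjc_wave waveDl; ring.
Qed.

(** Different [p] share no frequency, so every term vanishes; for equal [p] only the diagonal of the
    double sum remains, and it is the product of two rows of the Fourier matrix. *)
Lemma Bfam_orthonormal (j k : Bindex alpha) :
  L2inner (Bfam j) (Bfam k) = (j == k)%:R.
Proof.
case: j k => [p tau] [q tau']; rewrite /Bfam /= L2inner_B.
have [pq|pq] := eqVneq p q; last first.
  rewrite big1 => [|k _]; last first.
    rewrite big1 => // l _; case: eqP; rewrite ?mulr0// => kl.
    have [epq _] := freq_inj alpha_ge0 (band_i_addE k) (band_i_addE l) kl.
    by rewrite epq eqxx in pq.
  by case: eqP => // -[] epq; rewrite epq eqxx in pq.
(* Writing the indices with [Tagged] over the same [p] lets [eq_Tagged] reduce equality of dependent
   pairs to equality of second components. *)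
subst q; rewrite -[RHS]/((Tagged (fun p : int => 'I_(beta p)) tau ==
  Tagged (fun p : int => 'I_(beta p)) tau')%:R).
rewrite eq_Tagged /= -sum_band_coef; apply: eq_bigr => k _.
rewrite (bigD1 k)//= eqxx mulr1 big1 ?addr0// => l lk.
by rewrite freq_band_eq eq_sym (negbTE lk) mulr0.
Qed.

(** Inverse discrete Fourier transform: the coefficient of [B p tau] is the conjugate of the matrix
    entry in the column of the frequency [n], and the columns are orthonormal too. *)
Lemma wave_in_span_Bfam n : in_span (@Bfam R alpha) (wave n).
Proof.
have [p [k0 [/andP[ik0 k0s] <-]]] := freq_cover alpha_ge0 n.
have {}k0s : (k0 - bi p < beta p)%N.
  by rewrite ltn_subLR// -band_sE.
pose j := Ordinal k0s.
have -> : k0 = (bi p + j)%N by rewrite /= subnKC.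
have -> : wave (freq p (bi p + j)) = fun t => \sum_(tau < beta p)
    (((Num.sqrt (beta p)%:R)^-1)%:C *
     wave (freq p (bi p + j)) (tau%:R / (beta p)%:R)) *
     Bfam (Tagged (fun p : int => 'I_(beta p)) tau) t.
  apply/funext => t; have BE (tau : 'I_(beta p)) :
      Bfam (Tagged (fun p : int => 'I_(beta p)) tau) t = B alpha p tau t by [].
  under eq_bigr do rewrite BE B_sum mulr_sumr.
  rewrite exchange_big (bigD1 j)//.
  have H (k : 'I_(beta p)) : \sum_(tau < beta p)
     (((Num.sqrt (beta p)%:R)^-1)%:C *
     wave (freq p (bi p + j)) (tau%:R / (beta p)%:R)) *
     (band_coef p tau k * wave (freq p (bi p + k)) t) =
     (k == j)%:R * wave (freq p (bi p + k)) t.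
    transitivity (wave (freq p (bi p + k)) t * ((beta p)%:R^-1 *
      \sum_(tau < beta p) wave (freq p (bi p + j) - freq p (bi p + k))
                               (tau%:R / (beta p)%:R))).
      rewrite !mulr_sumr; apply: eq_bigr => tau _.
      by rewrite -sqrt_betaV2 /band_coef waveDl; ring.
    (* Two frequencies of one band differ by less than its length, as [sum_wave] demands. *)
    rewrite sum_wave; last first.
      have := ltn_ord j; have := ltn_ord k.
      by rewrite !freqE /band_sign; case: ifP => _; lia.
    rewrite subr_eq0 freq_band_eq eq_sym; case: eqVneq => _.
      by rewrite mulVf ?beta_neq0// mulr1 mul1r.
    by rewrite !mulr0 mul0r.
  rewrite H eqxx mul1r big1 ?Monoid.mulm1 // => k kj.
  by rewrite H (negbTE kj) mul0r.
apply: in_span_sum => tau _; apply: in_spanZ; exact: in_span_gen.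
Qed.

End Orthonormal.

(** * Approximation in L^2 *)

Section Approximation.
Variable R : realType.
Local Notation Re := complex.Re.
Local Notation Im := complex.Im.
Local Notation normc := ComplexField.Normc.normc.
Local Notation mu := (@lebesgue_measure R).
Local Notation I01 := (`[0%R, 1%R]%classic : set R).
Implicit Types f g : R -> R[i].

Definition sqr_norm f x : R := normc (f x) ^+ 2.

(** The square of the L^2 norm. Errors are measured by it so that estimates follow from pointwise
    inequalities, without roots. *)
Definition dist2 f : \bar R := (\int[mu]_(x in I01) (sqr_norm f x)%:E)%E.

Definition cmeasurable f : Prop :=
  measurable_fun I01 (fun x => Re (f x)) /\ measurable_fun I01 (fun x => Im (f x)).

Lemma L2normE f : L2norm f = ((dist2 f) `^ 2^-1)%E.
Proof.
rewrite /L2norm unlock /dist2 [in RHS]integral_mkcond; congr (_ `^ _)%E.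
apply: eq_integral => x _; rewrite !patchE; case: ifP => _; last first.
  by rewrite abse0 poweR_EFin powR0.
rewrite abse_EFin poweR_EFin powR_mulrn// ger0_norm//.
by case: (f x) => a b; exact: sqrtr_ge0.
Qed.

Lemma L2norm_lt f (e : R) : 0 < e -> (dist2 f < (e ^+ 2)%:E)%E ->
  (L2norm f < e%:E)%E.
Proof.
move=> e0; rewrite L2normE => fe.
have d0 : (0 <= dist2 f)%E.
  by apply: integral_ge0 => x _; rewrite lee_fin sqr_ge0.
have dfin : dist2 f \is a fin_num by rewrite ge0_fin_numE// (lt_trans fe) ?ltry.
rewrite -(fineK dfin) lte_fin in fe; rewrite -(fineK dfin) lee_fin in d0.
rewrite -(fineK dfin) poweR_EFin lte_fin.
rewrite -[ltRHS]ger0_norm ?ltW// -sqrtr_sqr -powR12_sqrt ?sqr_ge0//.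
by rewrite gt0_ltr_powR ?invr_gt0// nnegrE ?sqr_ge0.
Qed.

Lemma cmeasurableB f g : cmeasurable f -> cmeasurable g ->
  cmeasurable (fun x => f x - g x).
Proof.
move=> [mf nf] [mg ng]; split.
  by under [X in measurable_fun _ X]eq_fun do rewrite Re_subc; exact: measurable_funB.
by under [X in measurable_fun _ X]eq_fun do rewrite Im_subc; exact: measurable_funB.
Qed.

Lemma cmeasurableD f g : cmeasurable f -> cmeasurable g ->
  cmeasurable (fun x => f x + g x).
Proof.
move=> [mf nf] [mg ng]; split.
  by under [X in measurable_fun _ X]eq_fun do rewrite Re_addc; exact: measurable_funD.
by under [X in measurable_fun _ X]eq_fun do rewrite Im_addc; exact: measurable_funD.
Qed.

Lemma cmeasurableZ (a : R[i]) f : cmeasurable f -> cmeasurable (fun x => a * f x).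
Proof.
move=> [mf nf]; split.
  under [X in measurable_fun _ X]eq_fun do rewrite Re_mulc.
  by apply: measurable_funB; apply: measurable_funM.
under [X in measurable_fun _ X]eq_fun do rewrite Im_mulc.
by apply: measurable_funD; apply: measurable_funM.
Qed.

Lemma cmeasurable_real (h : R -> R) : measurable_fun I01 h ->
  cmeasurable (fun x => (h x)%:C).
Proof. by move=> mh; split => //=. Qed.

Lemma cmeasurable_span f : in_span wave f -> cmeasurable f.
Proof.
move=> /ccontinuous_span[cf df].
by split; apply: measurable_funTS; exact: continuous_measurable_fun.
Qed.

Lemma measurable_sqr_norm f : cmeasurable f ->
  measurable_fun I01 (fun x => (sqr_norm f x)%:E).
Proof.
move=> [mf nf]; apply/measurable_EFinP; rewrite /sqr_norm.
under [X in measurable_fun _ X]eq_fun do rewrite sqr_normcE.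
by apply: measurable_funD; exact: measurable_funX.
Qed.

(** Integrates [(u + v)^2 <= 2 u^2 + 2 v^2], applied to the real and imaginary parts; the factor 2
    is harmless for density. *)
Lemma dist2_triangle f g h : cmeasurable f -> cmeasurable g -> cmeasurable h ->
  (dist2 (fun x => f x - h x)%R <=
   2%:E * dist2 (fun x => f x - g x)%R + 2%:E * dist2 (fun x => g x - h x)%R)%E.
Proof.
move=> mf mg mh; rewrite /dist2.
have m1 := measurable_sqr_norm (cmeasurableB mf mh).
have m2 := measurable_sqr_norm (cmeasurableB mf mg).
have m3 := measurable_sqr_norm (cmeasurableB mg mh).
rewrite -!ge0_integralZl_EFin//; [|by move=> x _; rewrite lee_fin sqr_ge0..].
rewrite -ge0_integralD//.
- apply: ge0_le_integral => //.
  + by move=> x _; rewrite lee_fin sqr_ge0.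
  + by apply: emeasurable_funD; apply: measurable_funeM.
  + move=> x _; rewrite -!EFinM -EFinD lee_fin /sqr_norm !sqr_normcE !Re_subc !Im_subc.
    have sqrD2 (a b c : R) : (a - c) ^+ 2 <= 2 * (a - b) ^+ 2 + 2 * (b - c) ^+ 2.
      by have := sqr_ge0 (a - b - (b - c)); nra.
    by rewrite !mulrDr addrACA lerD.
- by move=> x _; rewrite mule_ge0// lee_fin ?sqr_ge0.
- exact: measurable_funeM.
- by move=> x _; rewrite mule_ge0// lee_fin ?sqr_ge0.
- exact: measurable_funeM.
Qed.

Definition trig_approx f : Prop := cmeasurable f /\
  forall e : R, 0 < e -> exists2 T, in_span wave T &
    (dist2 (fun x => f x - T x)%R < e%:E)%E.

Lemma dist20 f : (forall x, I01 x -> f x = 0) -> dist2 f = 0%E.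
Proof.
move=> f0; apply: integral0_eq => x Ix.
by rewrite /sqr_norm sqr_normcE f0// expr0n addr0.
Qed.

Lemma trig_approx_span T : in_span wave T -> trig_approx T.
Proof.
move=> eT; split; first exact: cmeasurable_span.
by move=> e e0; exists T => //; rewrite dist20 ?lte_fin// => x _; rewrite subrr.
Qed.

(** The closure of the trigonometric polynomials is closed. The tolerance [e / 4] absorbs the two
    factors 2 of [dist2_triangle]. *)
Lemma trig_approx_near f : cmeasurable f ->
  (forall e : R, 0 < e -> exists2 g, trig_approx g &
    (dist2 (fun x => f x - g x)%R < e%:E)%E) -> trig_approx f.
Proof.
move=> mf fg; split => // e e0.
have e4 : 0 < e / 4 by rewrite divr_gt0.
have [g [mg gT] fge] := fg _ e4; have [T sT gTe] := gT _ e4.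
exists T => //; apply: (le_lt_trans (dist2_triangle mf mg (cmeasurable_span sT))).
have -> : (e%:E = 2%:E * (e / 4)%:E + 2%:E * (e / 4)%:E)%E.
  by rewrite -!EFinM -EFinD; congr EFin; field.
by rewrite lteD// lte_pmul2l.
Qed.

Lemma trig_approxD f g : trig_approx f -> trig_approx g ->
  trig_approx (fun x => f x + g x).
Proof.
move=> [mf fT] [mg gT]; apply: (trig_approx_near (cmeasurableD mf mg)) => e e0.
have [T sT fTe] := fT _ e0.
(* One summand is replaced at a time: [T + g] differs from [f + g] by [f - T], and [T + S] from
   [T + g] by [g - S]. *)
exists (fun x => T x + g x); last first.
  by rewrite (_ : (fun x => _) = (fun x => f x - T x))//; apply/funext => x; ring.
have mT := cmeasurable_span sT.
split; first exact: cmeasurableD.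
move=> d d0; have [S sS gSd] := gT _ d0.
exists (fun x => T x + S x); first exact: in_spanD.
by rewrite (_ : (fun x => _) = (fun x => g x - S x))//; apply/funext => x; ring.
Qed.

Lemma trig_approxZ a f : trig_approx f -> trig_approx (fun x => a * f x).
Proof.
move=> [mf fT]; split; first exact: cmeasurableZ.
(* The added 1 keeps the divisor of the tolerance positive when [a = 0]. *)
have a1 : 0 < normc a ^+ 2 + 1 by rewrite ltr_wpDl ?sqr_ge0.
move=> e e0; have [T sT fTe] := fT _ (divr_gt0 e0 a1).
exists (fun x => a * T x); first exact: in_spanZ.
have mB := measurable_sqr_norm (cmeasurableB mf (cmeasurable_span sT)).
have -> : dist2 (fun x => a * f x - a * T x) =
    ((normc a ^+ 2)%:E * dist2 (fun x => f x - T x)%R)%E.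
  rewrite -ge0_integralZl_EFin ?sqr_ge0//; last first.
    by move=> x _; rewrite lee_fin sqr_ge0.
  apply: eq_integral => x _.
  by rewrite -EFinM /sqr_norm -mulrBr ComplexField.Normc.normcM exprMn.
have d0 : (0 <= dist2 (fun x => f x - T x)%R)%E.
  by apply: integral_ge0 => x _; rewrite lee_fin sqr_ge0.
apply: (@le_lt_trans _ _ ((normc a ^+ 2 + 1)%:E * dist2 (fun x => f x - T x)%R)%E).
  by apply: lee_wpmul2r => //; rewrite lee_fin lerDl.
by rewrite -lte_pdivlMl// -EFinM mulrC.
Qed.

(** Dominated convergence applied to the squared errors, with bound [G] and limit 0, makes [f_ n]
    close to [f] for some [n]. *)
Lemma trig_approx_lim (f_ : nat -> R -> R[i]) f (G : R -> R) :
  (forall n, trig_approx (f_ n)) -> cmeasurable f ->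
  mu.-integrable I01 (EFin \o G) ->
  (forall n x, I01 x -> sqr_norm (fun x => f x - f_ n x) x <= G x) ->
  {ae mu, forall x, I01 x ->
     sqr_norm (fun x => f x - f_ n x) x @[n --> \oo] --> (0 : R)} ->
  trig_approx f.
Proof.
move=> af mf iG fG cf; apply: trig_approx_near => // e e0.
have mI : measurable I01 by exact: measurable_itv.
have m_ n := measurable_sqr_norm (cmeasurableB mf (proj1 (af n))).
have [] := @dominated_convergence _ _ _ mu I01 mI
  (fun n x => (sqr_norm (fun x => f x - f_ n x) x)%:E) (cst 0%E) (EFin \o G) m_.
- exact: measurable_cst.
- case: cf => N [mN N0 subN]; exists N; split => //.
  apply: subset_trans subN; apply: subsetC => x /= cfx Ix.
  by apply: cvg_EFin => /=; [exact: nearW|exact: cfx].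
- exact: iG.
- apply: aeW => x n Ix; rewrite /= ger0_norm ?sqr_ge0// lee_fin; exact: fG.
rewrite integral0 => _ _ /fine_cvgP[fin_int /cvgr_lt/(_ _ e0) lt_int].
have [n [fin_n lt_n]] : exists n,
    (dist2 (fun x => f x - f_ n x)%R \is a fin_num) /\
    fine (dist2 (fun x => f x - f_ n x)%R) < e.
  apply: (@filter_ex _ \oo); near=> n; split; near: n; [exact: fin_int|exact: lt_int].
by exists (f_ n) => //; rewrite -(fineK fin_n) lte_fin.
Unshelve. all: by end_near. Qed.

End Approximation.

(** * Approximation of rays *)

Section Powers.
Variable R : realType.
Implicit Types (y t : R) (m n : nat).

Lemma bernoulli_lower y m : 0 <= y <= 1 -> 1 - m%:R * y <= (1 - y) ^+ m.
Proof.
move=> /andP[y0 y1]; elim: m => [|m IH]; first by rewrite mul0r subr0 expr0.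
rewrite exprSr; apply: le_trans (ler_wpM2r _ IH); last by rewrite subr_ge0.
have m0 : 0 <= m%:R :> R by [].
by rewrite -natr1; nra.
Qed.

(** Since [m y <= (1 + y)^m], the left side is at most [(1 - y^2)^m <= 1]. *)
Lemma bernoulli_upper y m : 0 <= y <= 1 -> (1 - y) ^+ m * (m%:R * y) <= 1.
Proof.
move=> /andP[y0 y1].
have mle : m%:R * y <= (1 + y) ^+ m.
  elim: m => [|m IH]; first by rewrite mul0r expr0.
  have : 1 <= (1 + y) ^+ m by rewrite exprn_ege1// lerDl.
  by rewrite exprSr -natr1; nra.
have y10 : 0 <= 1 - y by rewrite subr_ge0.
apply: le_trans (ler_wpM2l (exprn_ge0 _ y10) mle) _.
by rewrite -exprMn exprn_ile1//; nra.
Qed.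

(** Tends to the indicator of [t < 1/2] on [[0, 1] \ {1/2}]. *)
Definition sharpen n t := (1 - t ^+ n) ^+ (2 ^ n).

Lemma sharpen_itv n t : 0 <= t <= 1 -> 0 <= sharpen n t <= 1.
Proof.
move=> /andP[t0 t1].
have y0 := exprn_ge0 n t0; have y1 := exprn_ile1 n t0 t1.
by rewrite /sharpen exprn_ge0 ?exprn_ile1// ?subr_ge0// lerBlDr lerDl.
Qed.

(** [bernoulli_lower] with [y = t^n] and [m = 2^n] gives the lower bound [1 - (2 t)^n], where
    [2 t < 1]. *)
Lemma sharpen_cvg1 t : 0 <= t < 2^-1 -> sharpen n t @[n --> \oo] --> (1 : R).
Proof.
move=> /andP[t0 t2].
have t1 : t <= 1 by lra.
have tn n : 0 <= t ^+ n <= 1 by rewrite exprn_ge0// exprn_ile1.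
apply: (@squeeze_cvgr _ \oo _ _ (fun n => 1 - (2 * t) ^+ n) (cst 1)).
- apply: nearW => n; have := sharpen_itv n (introT andP (conj t0 t1)).
  move=> /andP[_ ->]; rewrite andbT exprMn -natrX.
  exact: bernoulli_lower.
- rewrite -[X in _ --> X]subr0; apply: cvgB; first exact: cvg_cst.
  by apply: cvg_expr; rewrite ger0_norm; lra.
- exact: cvg_cst.
Qed.

(** [bernoulli_upper] with [y = t^n] and [m = 2^n] gives the upper bound [(2 t)^(-n)], where
    [2 t > 1]. *)
Lemma sharpen_cvg0 t : 2^-1 < t <= 1 -> sharpen n t @[n --> \oo] --> (0 : R).
Proof.
move=> /andP[t2 t1].
have t0 : 0 <= t by lra.
have tn n : 0 <= t ^+ n <= 1 by rewrite exprn_ge0// exprn_ile1.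
have tt0 : 0 < 2 * t by lra.
apply: (@squeeze_cvgr _ \oo _ _ (cst 0) (fun n => ((2 * t)^-1) ^+ n)).
- apply: nearW => n; have := sharpen_itv n (introT andP (conj t0 t1)).
  move=> /andP[-> _] /=; rewrite exprVn -[leRHS]mul1r ler_pdivlMr ?exprn_gt0//.
  rewrite exprMn.
  by have := bernoulli_upper (2 ^ n) (tn n); rewrite natrX.
- exact: cvg_cst.
- apply: cvg_expr; rewrite ger0_norm ?invr_ge0 ?ltW// invf_lt1//; lra.
Qed.

End Powers.

(** * The algebra of trigonometric polynomials *)

Section TrigPolynomials.
Variable R : realType.
Implicit Types f g : R -> R[i].

Lemma in_span_cst (a : R[i]) : in_span wave (fun=> a).
Proof.
by exists [:: (0, a)]; apply/funext => x; rewrite big_seq1 wave0l mulr1.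
Qed.

Lemma in_spanM f g : in_span wave f -> in_span wave g -> in_span wave (fun x => f x * g x).
Proof.
move=> [l ->] [m ->]; under eq_fun do rewrite mulr_suml.
apply: in_span_sum => p _; under eq_fun do rewrite mulr_sumr.
apply: in_span_sum => q _; under eq_fun do rewrite mulrACA -waveDl.
by apply: in_spanZ; exact: in_span_gen.
Qed.

Lemma in_spanX f n : in_span wave f -> in_span wave (fun x => f x ^+ n).
Proof.
move=> ef; elim: n => [|n IH].
  by under eq_fun do rewrite expr0; exact: in_span_cst.
by under eq_fun do rewrite exprS; exact: in_spanM.
Qed.

Lemma in_span_cos (a : R) : in_span wave (fun x => (cos (2 * pi * x - a))%:C).
Proof.
have -> : (fun x => (cos (2 * pi * x - a))%:C) = (fun x : R =>
    (2^-1 * expi (- a)) * wave 1 x + (2^-1 * expi a) * wave (- 1) x).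
  apply/funext => x.
  have e1 : expi (- a) * wave 1 x = expi (2 * pi * x - a).
    by rewrite /wave -expiD; congr expi; ring.
  have e2 : expi a * wave (- 1) x = (expi (2 * pi * x - a))^*%C.
    by rewrite conjc_expi /wave -expiD; congr expi; ring.
  apply: etrans (ReJ_add (expi (2 * pi * x - a))) _.
  by rewrite -e2 -e1 mulrC mulrDr !mulrA.
by apply: in_spanD; apply: in_spanZ; exact: in_span_gen.
Qed.

End TrigPolynomials.

Section Rays.
Variables (R : realType) (b : R).
Hypothesis b01 : 0 < b <= 1.

(** The product of sines in [ray_argE], expanded into a sum: this form shows a trigonometric
    polynomial with values in [0,1], the product form shows the sign of its difference with 1/2. *)
Definition ray_arg (x : R) : R :=
  2^-1 + cos (pi * b) / 4 - cos (2 * pi * x - pi * b) / 4.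

Lemma ray_argE x : ray_arg x = 2^-1 - sin (pi * x) * sin (pi * (b - x)) / 2.
Proof.
have -> : pi * (b - x) = pi * b - pi * x by ring.
have e1 : cos (pi * b) = cos (pi * x + (pi * b - pi * x)) by congr cos; ring.
have e2 : cos (2 * pi * x - pi * b) = cos (pi * x - (pi * b - pi * x)).
  by congr cos; ring.
by rewrite /ray_arg e1 e2 (cosD (pi * x)) (cosB (pi * x)); field.
Qed.

Lemma ray_arg_itv x : 0 <= ray_arg x <= 1.
Proof.
rewrite /ray_arg.
have := cos_geN1 (pi * b); have := cos_le1 (pi * b).
have := cos_geN1 (2 * pi * x - pi * b); have := cos_le1 (2 * pi * x - pi * b).
by lra.
Qed.

Lemma sin_pi_gt0 (x : R) : 0 < x < 1 -> 0 < sin (pi * x).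
Proof.
move=> /andP[x0 x1]; apply: sin_gt0_pi.
by rewrite mulr_gt0 ?pi_gt0//= -[ltRHS]mulr1 ltr_pM2l ?pi_gt0.
Qed.

Lemma ray_arg_lt x : 0 < x < 1 -> x < b -> ray_arg x < 2^-1.
Proof.
move=> x01 xb; rewrite ray_argE.
have s1 := sin_pi_gt0 x01.
have s2 : 0 < sin (pi * (b - x)) by apply: sin_pi_gt0;
  move: x01 b01 => /andP[? ?] /andP[? ?]; apply/andP; split; lra.
by have := mulr_gt0 s1 s2; lra.
Qed.

Lemma ray_arg_gt x : 0 < x < 1 -> b < x -> 2^-1 < ray_arg x.
Proof.
move=> x01 xb; rewrite ray_argE.
have s1 := sin_pi_gt0 x01.
have s2 : 0 < sin (pi * (x - b)) by apply: sin_pi_gt0;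
  move: x01 b01 => /andP[? ?] /andP[? ?]; apply/andP; split; lra.
have -> : pi * (b - x) = - (pi * (x - b)) by ring.
by rewrite sinN mulrN; have := mulr_gt0 s1 s2; lra.
Qed.

Lemma in_span_sharpen_ray_arg n : in_span wave (fun x => (sharpen n (ray_arg x))%:C).
Proof.
have sb : in_span wave (fun x => (ray_arg x)%:C).
  have -> : (fun x => (ray_arg x)%:C) = (fun x => (2^-1 + cos (pi * b) / 4)%:C +
      (- 4^-1)%:C * (cos (2 * pi * x - pi * b))%:C).
    by apply/funext => x; rewrite -rmorphM -rmorphD /ray_arg; congr _%:C; ring.
  by apply: in_spanD; [exact: in_span_cst|apply: in_spanZ; exact: in_span_cos].
under eq_fun do rewrite /sharpen rmorphXn rmorphB rmorphXn -mulN1r.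
apply: in_spanX; apply: in_spanD; first exact: in_span_cst.
by apply: in_spanZ; exact: in_spanX.
Qed.

End Rays.

(** * Density *)

Section Density.
Variable R : realType.
Local Notation Re := complex.Re.
Local Notation Im := complex.Im.
Local Notation mu := (@lebesgue_measure R).
Local Notation I01 := (`[0%R, 1%R]%classic : set R).
Implicit Types (f : R -> R[i]) (h : R -> R).

Definition rtrig_approx h : Prop := trig_approx (fun x => (h x)%:C).

Lemma rtrig_approx_lim (h_ : nat -> R -> R) h (G : R -> R) :
  (forall n, rtrig_approx (h_ n)) -> measurable_fun I01 h ->
  mu.-integrable I01 (EFin \o G) ->
  (forall n x, I01 x -> (h x - h_ n x) ^+ 2 <= G x) ->
  {ae mu, forall x, I01 x -> h_ n x @[n --> \oo] --> h x} -> rtrig_approx h.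
Proof.
move=> ah mh iG hG ch.
have sqrE n x : sqr_norm (fun x => (h x)%:C - (h_ n x)%:C) x = (h x - h_ n x) ^+ 2.
  by rewrite /sqr_norm sqr_normcE -rmorphB /= expr0n addr0.
apply: (trig_approx_lim ah (cmeasurable_real mh) iG).
  by move=> n x Ix; rewrite sqrE; exact: hG.
case: ch => N [mN N0 subN]; exists N; split => //.
apply: subset_trans subN; apply: subsetC => x /= chx Ix.
have c0 : h x - h_ n x @[n --> \oo] --> (0 : R).
  by rewrite -(subrr (h x)); apply: cvgB; [exact: cvg_cst|exact: chx].
rewrite (_ : (fun n => _) = fun n => (h x - h_ n x) * (h x - h_ n x)); last first.
  by apply/funext => n; rewrite sqrE expr2.
by rewrite -[X in _ --> X](mulr0 (0 : R)); exact: (cvgM c0 c0).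
Qed.

Lemma rtrig_approxD h (k : R -> R) : rtrig_approx h -> rtrig_approx k ->
  rtrig_approx (fun x => h x + k x).
Proof.
by rewrite /rtrig_approx; move=> ah ak; under eq_fun do rewrite rmorphD; exact: trig_approxD.
Qed.

Lemma rtrig_approxZ (a : R) h : rtrig_approx h -> rtrig_approx (fun x => a * h x).
Proof.
by rewrite /rtrig_approx => ah; under eq_fun do rewrite rmorphM; exact: trig_approxZ.
Qed.

Lemma rtrig_approx_cst (a : R) : rtrig_approx (fun=> a).
Proof. by apply: trig_approx_span; exact: in_span_cst. Qed.

Lemma rtrig_approx_sum (I : Type) (r : seq I) (F : I -> R -> R) :
  (forall i, rtrig_approx (F i)) -> rtrig_approx (fun x => \sum_(i <- r) F i x).
Proof.
move=> aF; elim: r => [|i r IH].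
  by under eq_fun do rewrite big_nil; exact: rtrig_approx_cst.
by under eq_fun do rewrite big_cons; exact: rtrig_approxD.
Qed.

Lemma rtrig_approx_eq h (k : R -> R) : measurable_fun I01 h -> {in I01, h =1 k} ->
  rtrig_approx k -> rtrig_approx h.
Proof.
move=> mh hk ak; apply: trig_approx_near; first exact: cmeasurable_real.
move=> e e0; exists (fun x => (k x)%:C) => //.
by rewrite dist20 ?lte_fin// => x Ix; rewrite hk ?subrr// inE.
Qed.

Lemma integrable_cst1 : mu.-integrable I01 (EFin \o cst 1).
Proof. by apply: continuous_integrable => x; exact: cst_continuous. Qed.

Lemma measurable_indic01 (A : set R) : measurable A ->
  measurable_fun I01 (\1_A : R -> R).
Proof. by move=> mA; apply: measurable_funTS; exact: measurable_indic. Qed.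

Lemma indic_itv01 (A : set R) x : 0 <= (\1_A x : R) <= 1.
Proof. by rewrite indicE; case: (x \in A); rewrite /= ?lexx ler01. Qed.

Lemma sqrB_itv01_le1 (a b : R) : 0 <= a <= 1 -> 0 <= b <= 1 -> (a - b) ^+ 2 <= 1.
Proof. by move=> /andP[? ?] /andP[? ?]; nra. Qed.

Lemma rtrig_approx_ray (b : R) : rtrig_approx (\1_`]-oo, b[).
Proof.
have mr : measurable (`]-oo, b[ : set R) by exact: measurable_itv.
(* For [b <= 0] the ray misses [0,1], and for [b > 1] it contains [0,1]; constants then suffice. *)
have [b0|b0] := leP b 0.
  apply: (rtrig_approx_eq (measurable_indic01 mr) _ (rtrig_approx_cst 0)) => x.
  rewrite inE /= in_itv/= indicE => /andP[x0 _].
  by rewrite memNset//= in_itv/=; apply/negP; rewrite -leNgt (le_trans b0).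
have [b1|b1] := ltP 1 b.
  apply: (rtrig_approx_eq (measurable_indic01 mr) _ (rtrig_approx_cst 1)) => x.
  rewrite inE /= in_itv/= indicE => /andP[_ x1].
  by rewrite mem_set//= in_itv/= (le_lt_trans x1).
have b01 : 0 < b <= 1 by rewrite b0.
apply: (@rtrig_approx_lim (fun n x => sharpen n (ray_arg b x)) _ (cst 1)).
- by move=> n; apply: trig_approx_span; exact: in_span_sharpen_ray_arg.
- exact: measurable_indic01.
- exact: integrable_cst1.
- move=> n x _; apply: sqrB_itv01_le1; first exact: indic_itv01.
  by apply: sharpen_itv; exact: ray_arg_itv.
(* At these three points a sine factor vanishes and [ray_arg] equals 1/2, where neither limit of
   [sharpen] applies; they form a null set. *)
exists [set 0; 1; b]; split.
- by apply: measurableU; [apply: measurableU|]; exact: measurable_set1.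
- apply: countable_lebesgue_measure0; apply: finite_set_countable.
  by rewrite !finite_setU; split; [split|]; exact: finite_set1.
move=> x /= /not_implyP[Ix]; apply: contra_notP => /not_orP[/not_orP[x0 x1] xb].
have x01 : 0 < x < 1.
  move: Ix; rewrite in_itv/= !le_eqVlt => /andP[/predU1P[/esym//|->] /predU1P[//|->]].
  by [].
rewrite indicE; case: (ltgtP x b) => [xltb|bltx|//].
  rewrite mem_set /= ?in_itv//=; apply: sharpen_cvg1.
  by have /andP[-> _] := ray_arg_itv b x; rewrite ray_arg_lt.
rewrite memNset /=; last by rewrite in_itv/=; apply/negP; rewrite -leNgt ltW.
apply: sharpen_cvg0.
by have /andP[_ ->] := ray_arg_itv b x; rewrite ray_arg_gt.
Qed.

Lemma rtrig_approx_indic (A : set R) : measurable A -> rtrig_approx (\1_A).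
Proof.
pose G := @RGenInftyO.G R.
have RG : @measurable _ (measurableTypeR R) = <<s G >>.
  exact: RGenInftyO.measurableE.
move=> mA; have : <<s G >> A by rewrite -RG.
apply: (@dynkin_induction _ (measurableTypeR R) G (fun A => rtrig_approx (\1_A))).
- exact: RG.
- move=> _ _ [x ->] [y ->]; exists (Num.min x y); apply/seteqP; split=> z /=;
    by rewrite !in_itv/= lt_min => /andP.
- by rewrite indicT; exact: rtrig_approx_cst.
- by move=> _ [x ->]; exact: rtrig_approx_ray.
- move=> S mS aS; have -> : \1_(~` S) = (fun x => 1 + -1 * \1_S x) :> (R -> R).
    apply/funext => x; rewrite indicC indicE; case: (x \in S) => /=; ring.
  by apply: rtrig_approxD; [exact: rtrig_approx_cst|exact: rtrig_approxZ].
move=> F mF tF aF.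
(* By disjointness, a point of [F k] lies in no other set, so the partial sums jump from 0 to 1 once
   [n] exceeds [k]. *)
have sumE (n k : nat) (x : R) : F k x ->
    \sum_(i <- iota 0 n) (\1_(F i) x : R) = (k < n)%:R.
  move=> Fkx; elim: n => [|n IH]; first by rewrite big_nil.
  rewrite -addn1 iotaD big_cat big_seq1 IH add0n indicE addn1 ltnS /= [in RHS]leq_eqVlt.
  have [nk|nk] := eqVneq k n.
    by rewrite -nk mem_set// ltnn add0r.
  rewrite memNset ?addr0// => Fnx.
  by move/eqP: nk; apply; apply: (tF k n) => //; exists x.
have sum0 (n : nat) (x : R) : ~ (\bigcup_k F k) x ->
    \sum_(i <- iota 0 n) (\1_(F i) x : R) = 0.
  move=> Fx; rewrite big1// => i _; rewrite indicE memNset// => Fix.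
  by apply: Fx; exists i.
apply: (@rtrig_approx_lim (fun n x => \sum_(i <- iota 0 n) \1_(F i) x) _ (cst 1)).
- by move=> n; exact: rtrig_approx_sum.
- by apply: measurable_indic01; apply: bigcup_measurable => i _; exact: mF.
- exact: integrable_cst1.
- move=> n x _; apply: sqrB_itv01_le1; first exact: indic_itv01.
  have [[k _ /sumE->]|/sum0->] := pselect ((\bigcup_k F k) x).
    by case: (k < n)%N; rewrite /= ?lexx ler01.
  by rewrite lexx ler01.
apply: aeW => x _; rewrite indicE.
have [Fx|Fx] := pselect ((\bigcup_k F k) x).
  have [k _ Fkx] := Fx; rewrite mem_set//; apply: cvg_near_cst.
  by exists k.+1 => // n /= kn; rewrite (sumE _ _ _ Fkx) kn.
rewrite memNset//; apply: cvg_near_cst; apply: nearW => n.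
exact: sum0.
Qed.

Import HBNNSimple.

Lemma rtrig_approx_nnsfun (g : {nnsfun R >-> R}) : rtrig_approx g.
Proof.
pose r := finmap.enum_fset (fset_set (range g)).
rewrite (_ : (g : R -> R) = fun x =>
    \sum_(i < size r) r`_i * \1_(g @^-1` [set r`_i]) x); last first.
  by apply/funext => x; exact: fimfunEord.
apply: rtrig_approx_sum => i; apply: rtrig_approxZ; apply: rtrig_approx_indic.
exact: (measurable_funPTI g (measurable_set1 _)).
Qed.

(** The simple functions [g n] increase to [h] with [0 <= g n <= h], whence
    [(h - g n)^2 <= h^2 <= G]. *)
Lemma rtrig_approx_nonneg h (G : R -> R) : measurable_fun I01 h ->
  (forall x, I01 x -> 0 <= h x) ->
  mu.-integrable I01 (EFin \o G) ->
  (forall x, I01 x -> h x ^+ 2 <= G x) -> rtrig_approx h.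
Proof.
move=> mh h0 iG hG.
have mI : measurable I01 by exact: measurable_itv.
have mEh : measurable_fun I01 (EFin \o h) by apply/measurable_EFinP.
pose g := nnsfun_approx mI mEh.
have h0E x : I01 x -> (0 <= (EFin \o h) x)%E by move=> Ix; rewrite lee_fin h0.
apply: (@rtrig_approx_lim g _ G) => //.
- by move=> n; exact: rtrig_approx_nnsfun.
- move=> n x Ix; apply: le_trans (hG x Ix).
  have gle : g n x <= h x by rewrite -lee_fin /g nnsfun_approxE; exact: le_approx.
  have ge0 : 0 <= g n x by [].
  have := h0 x Ix; nra.
by apply: aeW => x Ix; have /fine_cvg := cvg_nnsfun_approx mI mEh h0E Ix.
Qed.

Lemma rtrig_approx_dominated h (G : R -> R) : measurable_fun I01 h ->
  mu.-integrable I01 (EFin \o G) ->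
  (forall x, I01 x -> h x ^+ 2 <= G x) -> rtrig_approx h.
Proof.
move=> mh iG hG.
(* Positive minus negative part, the squares of both being at most [h^2]. *)
have -> : h = fun x => Num.max (h x) 0 + -1 * Num.max (- h x) 0.
  by apply/funext => x; case: (leP (h x) 0); case: (leP (- h x) 0); lra.
have msqr (a : R) : Num.max a 0 ^+ 2 <= a ^+ 2.
  by case: (leP a 0) => _; rewrite ?expr0n ?sqr_ge0.
apply: rtrig_approxD; [|apply: rtrig_approxZ].
- apply: (@rtrig_approx_nonneg _ G) => //.
  + by apply: measurable_maxr.
  + by move=> x _; rewrite le_max lexx orbT.
  + by move=> x Ix; apply: le_trans (hG x Ix); exact: msqr.
- apply: (@rtrig_approx_nonneg _ G) => //.
  + by apply: measurable_maxr => //; exact: measurable_funN.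
  + by move=> x _; rewrite le_max lexx orbT.
  + by move=> x Ix; apply: le_trans (hG x Ix); rewrite -[leRHS]sqrrN; exact: msqr.
Qed.

(** The real and imaginary parts are treated separately; [|f|^2] is integrable and dominates the
    square of each. *)
Lemma trig_approx_inL2 f : inL2 f -> trig_approx f.
Proof.
move=> [mf nf]; rewrite L2normE => /lty_poweRy f2.
have {}f2 : (dist2 f < +oo)%E by apply: f2.
have iG : mu.-integrable I01 (EFin \o sqr_norm f).
  apply/integrableP; split; first exact: measurable_sqr_norm.
  apply: le_lt_trans f2; rewrite le_eqVlt; apply/orP; left; apply/eqP.
  by apply: eq_integral => x _; rewrite /= ger0_norm// sqr_ge0.
have -> : f = fun x => (Re (f x))%:C + 'i%C * (Im (f x))%:C.
  by apply/funext => x; exact: complexE.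
apply: trig_approxD; [|apply: trig_approxZ].
- apply: (rtrig_approx_dominated mf iG) => x _.
  by rewrite /sqr_norm sqr_normcE lerDl sqr_ge0.
- apply: (rtrig_approx_dominated nf iG) => x _.
  by rewrite /sqr_norm sqr_normcE lerDr sqr_ge0.
Qed.

Lemma ccontinuous_inL2 f : ccontinuous f -> inL2 f.
Proof.
move=> [cf df]; split.
- by apply: measurable_funTS; exact: continuous_measurable_fun.
- by apply: measurable_funTS; exact: continuous_measurable_fun.
rewrite L2normE; apply: poweR_lty.
have : mu.-integrable I01 (EFin \o sqr_norm f).
  apply: continuous_integrable => x; rewrite /sqr_norm.
  under eq_fun do rewrite sqr_normcE !expr2.
  by apply: cvgD; apply: cvgM; (exact: cf || exact: df).
by apply: integrable_lty; exact: measurable_itv.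
Qed.

End Density.

Theorem theorem3p2 (R : realType) (alpha : R)
    (alpha_ge0 : 0 <= alpha) (alpha_le1 : alpha <= 1) :
  orthonormal_basis (@Bfam R alpha).
Proof.
split.
- case=> p tau; apply: ccontinuous_inL2; apply: ccontinuous_span.
  rewrite /Bfam /=.
  have -> : B alpha p tau = fun t => \sum_(k < band_beta alpha `|p|)
      band_coef alpha p tau k * wave (freq p (band_i alpha `|p| + k)) t.
    by apply/funext => t; exact: B_sum.
  by apply: in_span_sum => k _; apply: in_spanZ; exact: in_span_gen.
- exact: Bfam_orthonormal.
(* The tolerance is [e^2] because [trig_approx] bounds the squared norm. The polynomial [T] obtained
   is then rewritten as a combination of the family, which spans every exponential. *)
- move=> f L2f e e0; have [_ /(_ _ (exprn_gt0 2 e0))[T sT fT]] := trig_approx_inL2 L2f.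
  have [s [c Tsc]] := in_span_uniq (in_span_trans (wave_in_span_Bfam alpha_ge0) sT).
  exists s, c; apply: L2norm_lt => //.
  by rewrite Tsc in fT.
Qed.
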